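(* Let $Y$ be a finite-dimensional real Banach space, and let $Z=(\mathbb{R}^2,\|\cdot\|_Z)$ be a two-dimensional normed space with $\|(1,0)\|_Z=\|(0,1)\|_Z=1$ and $\|(a,b)\|_Z=\|(\pm a,\pm b)\|_Z$ for all $(a,b)\in\mathbb{R}^2$ and all choices of signs. Let $c_Z$ be the constant defined in the context. Then for every $\varepsilon\in(0,1)$ and every pair $(r,R)$ of positive numbers satisfying $$\frac{\varepsilon}{c_Z}\ln\left(\frac Rr\right)=\frac{\pi}{2},$$ there is a $\left(\frac{1+\varepsilon}{1-\varepsilon}\right)$-bending $T$ of $Y$ in the sum $X=Y\oplus_Z Y$ with parameters $(r,R)$. Furthermore, $T$ satisfies $$\|Tx\|_X=\|x\|_Y\quad\text{for all }x\in Y,$$ and $$(1-\varepsilon)\|x-y\|_Y\le\|Tx-Ty\|_X\le(1+\varepsilon)\|x-y\|_Y\quad\text{for all }x,y\in Y.$$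
   Context: $Y\oplus_Z Y$ is the space of pairs $(u,v)$, $u,v\in Y$, with norm $\|(u,v)\|=\|(\|u\|_Y,\|v\|_Y)\|_Z$. For $\tau\in\mathbb{R}$ put $u(\tau)=\dfrac{(\cos\tau,\sin\tau)}{\|(\cos\tau,\sin\tau)\|_Z}\in Z$, and $$c_Z:=\sup_{0\le\tau_1<\tau_2\le\pi/2}\frac{\|u(\tau_2)-u(\tau_1)\|_Z}{\tau_2-\tau_1}$$ (this supremum is finite and positive). For $C\in[1,\infty)$ and $0<r<R<\infty$, a $C$-bending of $Y$ in $X=Y\oplus_Z Y$ with parameters $(r,R)$ is a map $T:Y\to X$ which is a bilipschitz embedding of distortion $\mathrm{Lip}(T)\cdot\mathrm{Lip}(T^{-1}|_{T(Y)})\le C$, such that $T(y)=(y,0)$ for all $y$ in the ball $\{\|y\|_Y\le r\}$ and $T(y)=(0,y)$ for all $y$ in the exterior $\{\|y\|_Y\ge R\}$ of the ball of radius $R$. *)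

(* Defs.v *)
From HB Require Import structures.
From mathcomp Require Import all_boot all_order all_algebra.
From mathcomp Require Import all_classical all_reals all_analysis.
From mathcomp Require Import ring.

Set Implicit Arguments.
Unset Strict Implicit.
Unset Printing Implicit Defensive.

Import Order.TTheory GRing.Theory Num.Theory.
Import numFieldNormedType.Exports.

Local Open Scope classical_set_scope.
Local Open Scope ring_scope.

(* [Vector.axiom n V] is the data of a linear bijection between V and the row
   vectors of length n. *)
Definition finite_dimensional (R : realType) (V : normedModType R) : Prop :=
  exists n : nat, inhabited (Vector.axiom n V).

Record absoluteNorm (R : realType) := AbsoluteNorm {
  anorm : R * R -> R ;
  anormD : forall a b c d,
    anorm (a + c, b + d) <= anorm (a, b) + anorm (c, d) ;
  anormZ : forall k a b, anorm (k * a, k * b) = `|k| * anorm (a, b) ;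
  anorm_eq0 : forall a b, anorm (a, b) = 0 -> a = 0 /\ b = 0 ;
  anorm10 : anorm (1, 0) = 1 ;
  anorm01 : anorm (0, 1) = 1 ;
  anorm_sign : forall (s t : bool) a b,
    anorm ((-1) ^+ s * a, (-1) ^+ t * b) = anorm (a, b)
}.

(* The aliases [plane Z] and [zsum Y Z] keep the linear structure of the
   product but not its norm, which in the library is the max-norm. *)
Definition plane (R : realType) (Z : absoluteNorm R) : Type := (R^o * R^o)%type.

Section plane_normed.
Variables (R : realType) (Z : absoluteNorm R).

HB.instance Definition _ := GRing.Lmodule.copy (plane Z) (R^o * R^o)%type.

Let plane_norm (p : plane Z) : R := anorm Z p.

Let plane_normD (p q : plane Z) :
  plane_norm (p + q) <= plane_norm p + plane_norm q.
Proof. by case: p q => [a b] [c d]; exact: anormD. Qed.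

Let plane_normZ (k : R) (p : plane Z) :
  plane_norm (k *: p) = `|k| * plane_norm p.
Proof. by case: p => a b; exact: anormZ. Qed.

Let plane_norm_eq0 (p : plane Z) : plane_norm p = 0 -> p = 0.
Proof. by case: p => a b /anorm_eq0[-> ->]. Qed.

HB.instance Definition _ := Lmodule_isNormed.Build R (plane Z)
  plane_normD plane_normZ plane_norm_eq0.

Lemma plane_normE (p : plane Z) : `|p| = anorm Z p.
Proof. by []. Qed.

End plane_normed.

Section absoluteNorm_monotone.
Variables (R : realType) (Z : absoluteNorm R).

Lemma anormN1 (a b : R) : anorm Z (- a, b) = anorm Z (a, b).
Proof. by rewrite -(anorm_sign Z true false a b) expr1 expr0 mulN1r mul1r. Qed.

Lemma anormN2 (a b : R) : anorm Z (a, - b) = anorm Z (a, b).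
Proof. by rewrite -(anorm_sign Z false true a b) expr1 expr0 mulN1r mul1r. Qed.

Let convl (a c : R) : 0 <= a -> a <= c ->
  exists2 t : R, 0 <= t <= 1 & a = t * c + (1 - t) * (- c).
Proof.
move=> a0 ac; have [c0|c0] := eqVneq c 0.
  exists 0; first by rewrite lexx ler01.
  by rewrite c0 in ac *; rewrite oppr0 !mulr0 addr0; apply/le_anti/andP.
have cp : 0 < c by rewrite lt_neqAle eq_sym c0 (le_trans a0 ac).
exists ((1 + a / c) / 2).
  rewrite divr_ge0 ?addr_ge0 ?divr_ge0 ?(ltW cp)//=.
  by rewrite ler_pdivrMr// mul1r lerD2l ler_pdivrMr// mul1r.
by field.
Qed.

Lemma ler_anorm (a b c d : R) : 0 <= a -> a <= c -> 0 <= b -> b <= d ->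
  anorm Z (a, b) <= anorm Z (c, d).
Proof.
move=> a0 ac b0 bd; apply: (@le_trans _ _ (anorm Z (c, b))).
  have [t /andP[t0 t1] ->] := convl a0 ac.
  have {1}-> : b = t * b + (1 - t) * b by rewrite -mulrDl addrC subrK mul1r.
  apply: (le_trans (anormD _ _ _ _ _)).
  rewrite !anormZ anormN1 -mulrDl !ger0_norm ?subr_ge0//.
  by rewrite [t + _]addrC subrK mul1r.
have [t /andP[t0 t1] ->] := convl b0 bd.
have {1}-> : c = t * c + (1 - t) * c by rewrite -mulrDl addrC subrK mul1r.
apply: (le_trans (anormD _ _ _ _ _)).
rewrite !anormZ anormN2 -mulrDl !ger0_norm ?subr_ge0//.
by rewrite [t + _]addrC subrK mul1r.
Qed.

End absoluteNorm_monotone.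

Definition zsum (R : realType) (Y : normedModType R) (Z : absoluteNorm R) : Type :=
  (Y * Y)%type.

Section zsum_normed.
Variables (R : realType) (Y : normedModType R) (Z : absoluteNorm R).

HB.instance Definition _ := GRing.Lmodule.copy (zsum Y Z) (Y * Y)%type.

Let zsum_norm (p : zsum Y Z) : R := anorm Z (`|p.1|, `|p.2|).

Let zsum_normD (p q : zsum Y Z) :
  zsum_norm (p + q) <= zsum_norm p + zsum_norm q.
Proof.
apply: le_trans (anormD _ _ _ _ _).
by apply: ler_anorm; rewrite ?normr_ge0 ?ler_normD.
Qed.

Let zsum_normZ (k : R) (p : zsum Y Z) :
  zsum_norm (k *: p) = `|k| * zsum_norm p.
Proof. by rewrite /zsum_norm !normrZ anormZ normr_id. Qed.

Let zsum_norm_eq0 (p : zsum Y Z) : zsum_norm p = 0 -> p = 0.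
Proof.
by case: p => u v /anorm_eq0[/normr0_eq0 /= -> /normr0_eq0 /= ->].
Qed.

HB.instance Definition _ := Lmodule_isNormed.Build R (zsum Y Z)
  zsum_normD zsum_normZ zsum_norm_eq0.

Lemma zsum_normE (p : zsum Y Z) : `|p| = anorm Z (`|p.1|, `|p.2|).
Proof. by []. Qed.

End zsum_normed.

Definition zdir (R : realType) (Z : absoluteNorm R) (t : R) : plane Z :=
  let p : plane Z := (cos t, sin t) in `|p|^-1 *: p.

Definition zconst (R : realType) (Z : absoluteNorm R) : R :=
  sup [set q : R | exists t1 t2 : R,
    [/\ 0 <= t1, t1 < t2, t2 <= pi / 2 &
        q = `|zdir Z t2 - zdir Z t1| / (t2 - t1)]].

(* Least Lipschitz constant of f on A, +oo if f is not Lipschitz on A. *)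
Definition lip (R : realType) (V W : normedModType R) (A : set V) (f : V -> W)
  : \bar R :=
  ereal_inf [set k%:E | k in [set k : R | 0 <= k /\ k.-lipschitz_A f]].

(* [pinv setT T] is the inverse of T on [range T] when T is injective. *)
Definition lip_inv (R : realType) (V W : normedModType R) (T : V -> W) : \bar R :=
  lip (range T) (pinv setT T).

Definition bilipschitz_embedding (R : realType) (V W : normedModType R)
    (T : V -> W) : Prop :=
  [/\ injective T, (lip setT T < +oo)%E & (lip_inv T < +oo)%E].

Definition distortion (R : realType) (V W : normedModType R) (T : V -> W)
  : \bar R := (lip setT T * lip_inv T)%E.

Definition bending (R : realType) (Y : normedModType R) (Z : absoluteNorm R)
    (C r rho : R) (T : Y -> zsum Y Z) : Prop :=
  [/\ 1 <= C, 0 < r < rho,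
      bilipschitz_embedding T /\ (distortion T <= C%:E)%E,
      (forall y, `|y| <= r -> T y = (y, 0)) &
      (forall y, rho <= `|y| -> T y = (0, y))].

(* Main.v *)
Require Import Defs.
From HB Require Import structures.
From mathcomp Require Import all_boot all_order all_algebra.
From mathcomp Require Import all_classical all_reals all_analysis.
From mathcomp Require Import lra.

Import Order.TTheory GRing.Theory Num.Theory.
Import numFieldNormedType.Exports.

Local Open Scope classical_set_scope.
Local Open Scope ring_scope.

(** With [u = zdir Z] and [u * x := (u.1 *: x, u.2 *: x)], the bending is
    [T x = u(tau |x|) * x], where [tau s = (eps / c_Z) ln (s / r)], truncated to
    [[0, pi/2]]. Since [|u| = 1], for [|y| <= |x|] the decomposition
    [T x - T y = u(tau |x|) * (x - y) + (u(tau |x|) - u(tau |y|)) * y]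
    has a first term of norm exactly [|x - y|], while the second has norm at
    most [c_Z (tau |x| - tau |y|) |y| <= eps |y| ln (|x| / |y|)
    <= eps (|x| - |y|) <= eps |x - y|]. *)

Section bilipschitz.
Context {R : realType} {V W : normedModType R}.
Implicit Types (T : V -> W) (A : set V).

Lemma lip_ge0 A T : (0 <= lip A T)%E.
Proof. by apply: le_ereal_inf_tmp => _ [k [k0 _] <-]; rewrite lee_fin. Qed.

Lemma lip_le A T (k : R) : 0 <= k ->
  (forall x y, A x -> A y -> `|T x - T y| <= k * `|x - y|) ->
  (lip A T <= k%:E)%E.
Proof.
move=> k0 Tk; apply: ereal_inf_lbound; exists k => //; split=> //.
by move=> [x y] [/= Ax Ay]; exact: Tk.
Qed.

End bilipschitz.

Section distortion.
Context {R : realType} {V W : normedModType R} {T : V -> W} {a b : R}.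
Hypotheses (a_gt0 : 0 < a) (b_ge0 : 0 <= b).
Hypothesis lowerT : forall x y, a * `|x - y| <= `|T x - T y|.
Hypothesis upperT : forall x y, `|T x - T y| <= b * `|x - y|.

Let injT : injective T.
Proof.
move=> x y Txy; have := lowerT x y; rewrite Txy subrr normr0.
by rewrite pmulr_rle0// normr_le0 subr_eq0 => /eqP.
Qed.

Let lipT : (lip setT T <= b%:E)%E.
Proof. by apply: lip_le => // x y _ _; exact: upperT. Qed.

Let lip_invT : (lip_inv T <= a^-1%:E)%E.
Proof.
apply: lip_le; first by rewrite invr_ge0 ltW.
have TK x : pinv setT T (T x) = x.
  by apply: pinvKV; [move=> ? ? _ _; exact: injT|exact: mem_setT].
by move=> _ _ [x _ <-] [y _ <-]; rewrite !TK mulrC ler_pdivlMr// mulrC.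
Qed.

Lemma bilipschitz_embedding_bounds : bilipschitz_embedding T.
Proof.
by split => //; [apply: le_lt_trans lipT _|apply: le_lt_trans lip_invT _];
  rewrite ltry.
Qed.

Lemma distortion_le : (distortion T <= (b / a)%:E)%E.
Proof. by rewrite EFinM lee_pmul// lip_ge0. Qed.

End distortion.

Section plane_action.
Context {R : realType} {Y : normedModType R} {Z : absoluteNorm R}.
Implicit Types (p q : plane Z) (x y : Y).

(** Identifying $Y\oplus_Z Y$ with $Z\otimes Y$, this is the elementary tensor of [p] and [y]; it is
    the product [u * x] of the construction. *)
Definition zscale p y : zsum Y Z := (p.1 *: y, p.2 *: y).

Lemma anorm_abs (a b : R) : anorm Z (`|a|, `|b|) = anorm Z (a, b).
Proof.
by case: (ger0P a) => _; case: (ger0P b) => _; rewrite ?anormN1 ?anormN2.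
Qed.

(** Homogeneity pulls [|y|] out of the plane norm, and sign invariance removes the absolute values
    left on the coordinates of [p]. *)
Lemma norm_zscale p y : `|zscale p y| = `|p| * `|y|.
Proof.
case: p => a b; rewrite zsum_normE plane_normE /= !normrZ.
by rewrite ![_ * `|y|]mulrC anormZ normr_id anorm_abs.
Qed.

Lemma zscale_sub p q x y :
  zscale p x - zscale q y = zscale p (x - y) + zscale (p - q) y.
Proof.
case: p q => a b [c d]; rewrite /zscale /=.
by congr pair => /=; rewrite scalerBr scalerBl addrA subrK.
Qed.

End plane_action.

Section zdir.
Context {R : realType} {Z : absoluteNorm R}.

Lemma norm_zdir (t : R) : `|zdir Z t| = 1.
Proof.
rewrite /zdir normrZ normfV normr_id mulVf// normr_eq0; apply/eqP => -[c0 s0].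
by have := cos2Dsin2 t; rewrite c0 s0 expr0n/= addr0 => /esym/eqP; rewrite oner_eq0.
Qed.

Lemma zdir0 : zdir Z 0 = (1, 0).
Proof.
by rewrite /zdir cos0 sin0 plane_normE anorm10 invr1 scale1r.
Qed.

Lemma zdir_pihalf : zdir Z (pi / 2) = (0, 1).
Proof.
by rewrite /zdir cos_pihalf sin_pihalf plane_normE anorm01 invr1 scale1r.
Qed.

Lemma zconst_ge0 : 0 <= zconst Z.
Proof.
rewrite /zconst; set E := [set q | _].
(* Without a supremum, [sup E] takes the default value [0]; otherwise any quotient in [E] bounds it
   from below. *)
have [supE|/sup_out->//] := pselect (has_sup E).
have [[q Eq] _] := supE; apply: le_trans (sup_upper_bound supE Eq).
by case: Eq => t1 [t2 [_ t12 _ ->]]; rewrite divr_ge0// subr_ge0 ltW.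
Qed.

(* [sup] of an unbounded set is [0], so [zconst Z != 0] carries the
   boundedness of the difference quotients. *)
Lemma zdir_lipschitz (t1 t2 : R) : zconst Z != 0 ->
  0 <= t1 -> t1 <= t2 -> t2 <= pi / 2 ->
  `|zdir Z t2 - zdir Z t1| <= zconst Z * (t2 - t1).
Proof.
move=> c0 t10 t12 t2pi; have [->|t12n] := eqVneq t1 t2.
  by rewrite !subrr normr0 mulr0.
have {t12n}lt_t12 : t1 < t2 by rewrite lt_neqAle t12n.
rewrite -ler_pdivrMr ?subr_gt0//; move: c0; rewrite /zconst.
set E := [set q | _] => c0.
have supE : has_sup E by apply: contrapT => /sup_out/eqP; exact/negP.
by apply: (sup_upper_bound supE); exists t1, t2.
Qed.

End zdir.

Section angle.
Context {R : realType}.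
Implicit Types r rho s : R.

(** Clamping the radius rather than the angle keeps the argument of [ln] positive, even at
    [s = 0]. *)
Definition truncate r rho s : R := Order.min (Order.max s r) rho.

Lemma truncate_itv r rho s : r <= rho -> r <= truncate r rho s <= rho.
Proof.
by move=> rrho; rewrite /truncate le_min rrho le_max lexx orbT ge_min lexx orbT.
Qed.

(** For the clamped values [A] and [B], [ln A - ln B <= A / B - 1], and the factor [b <= B] cancels
    the denominator. The product form allows [b = 0]. *)
Lemma mul_ln_truncate_le r rho (a b : R) : 0 < r -> r <= rho ->
  0 <= b -> b <= a ->
  0 <= ln (truncate r rho a) - ln (truncate r rho b) /\
  b * (ln (truncate r rho a) - ln (truncate r rho b)) <= a - b.
Proof.
move=> r0 rrho b0 ba.
have /andP[ra arho] := truncate_itv r rho a rrho.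
have /andP[rb brho] := truncate_itv r rho b rrho.
(* [b] exceeds its clamped value only beyond [rho], where [a] clamps to [rho] too; otherwise the
   bound holds because clamping is 1-Lipschitz. *)
have tab : truncate r rho b <= truncate r rho a /\
    (b <= truncate r rho b /\
       truncate r rho a - truncate r rho b <= a - b \/
     truncate r rho a = truncate r rho b).
  rewrite /truncate.
  by case: (leP a r) => ?; case: (leP b r) => ?; case: (leP r rho) => ?;
    case: (leP a rho) => ?; case: (leP b rho) => ?;
    split; solve [lra | right; lra | left; lra].
move: tab ra rb.
move: (truncate r rho a) (truncate r rho b) => A B [BA tab] rA rB.
have B0 : 0 < B by exact: lt_le_trans rB.
have A0 : 0 < A by exact: lt_le_trans rA.
split; first by rewrite subr_ge0 ler_ln ?posrE.
case: tab => [[bB AB]|->]; last by rewrite subrr mulr0 subr_ge0.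
have AB1 : 0 <= A / B - 1 by rewrite subr_ge0 ler_pdivlMr// mul1r.
have lnAB : ln A - ln B <= A / B - 1.
  have := @le_ln1Dx R (A / B - 1).
  rewrite [1 + _]addrC subrK ln_div ?posrE//; apply.
  by apply: lt_le_trans AB1; rewrite ltrN10.
apply: le_trans (ler_wpM2l b0 lnAB) _.
apply: le_trans (ler_wpM2r AB1 bB) _.
by rewrite mulrBr mulr1 mulrC divfK// gt_eqF.
Qed.

End angle.

Theorem theorem3p4 (R : realType) (Y : completeNormedModType R)
    (Yfin : finite_dimensional Y) (Z : absoluteNorm R)
    (eps : R) (eps01 : 0 < eps < 1)
    (r rho : R) (r_gt0 : 0 < r) (rho_gt0 : 0 < rho)
    (hrrho : eps / zconst Z * ln (rho / r) = pi / 2) :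
  exists T : Y -> zsum Y Z,
    [/\ bending ((1 + eps) / (1 - eps)) r rho T,
        (forall x : Y, `|T x| = `|x|) &
        (forall x y : Y,
          (1 - eps) * `|x - y| <= `|T x - T y| <= (1 + eps) * `|x - y|)].
Proof.
have /andP[eps_gt0 eps_lt1] := eps01.
have pihalf_gt0 : 0 < pi / 2 :> R by rewrite divr_gt0// pi_gt0.
(* As [eps / 0] is [0], a vanishing constant would turn [hrrho] into [0 = pi / 2]. *)
have c_neq0 : zconst Z != 0.
  apply: contraTneq pihalf_gt0 => c0.
  by rewrite -hrrho c0 invr0 mulr0 mul0r ltxx.
have c_gt0 : 0 < zconst Z by rewrite lt_neqAle eq_sym c_neq0 zconst_ge0.
have k_gt0 : 0 < eps / zconst Z by rewrite divr_gt0.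
have r_lt_rho : r < rho.
  rewrite ltNge; apply/negP => rho_le_r.
  have : pi / 2 <= 0 :> R.
    rewrite -hrrho pmulr_rle0//; apply: ln_le0.
    by rewrite ler_pdivrMr// mul1r.
  by rewrite leNgt pihalf_gt0.
pose sg := truncate r rho.
have sgP s : r <= sg s <= rho by exact/truncate_itv/ltW.
have sg_gt0 s : 0 < sg s by have /andP[rs _] := sgP s; exact: lt_le_trans rs.
pose tau s := eps / zconst Z * ln (sg s / r).
have tau_ge0 s : 0 <= tau s.
  rewrite mulr_ge0 ?(ltW k_gt0)// ln_ge0// ler_pdivlMr// mul1r.
  by have /andP[] := sgP s.
(* By [hrrho], [pi / 2] is the angle reached at radius [rho]. *)
have tau_le s : tau s <= pi / 2.
  rewrite -hrrho ler_pM2l// ler_ln ?posrE ?divr_gt0// ler_pM2r ?invr_gt0//.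
  by have /andP[] := sgP s.
have tauB a b : tau a - tau b = eps / zconst Z * (ln (sg a) - ln (sg b)).
  by rewrite -mulrBr !ln_div ?posrE// opprB addrA subrK.
have rotation_le (x y : Y) : `|y| <= `|x| ->
    `|zdir Z (tau `|x|) - zdir Z (tau `|y|)| * `|y| <= eps * `|x - y|.
  move=> yx.
  have [ln_le mul_ln_le] := @mul_ln_truncate_le R _ _ _ _ r_gt0 (ltW r_lt_rho)
    (normr_ge0 y) yx.
  have tau_mono : tau `|y| <= tau `|x|.
    by rewrite -subr_ge0 tauB mulr_ge0// ltW.
  have zl := zdir_lipschitz _ _ c_neq0 (tau_ge0 _) tau_mono (tau_le _).
  apply: le_trans (ler_wpM2r (normr_ge0 y) zl) _.
  (* The Lipschitz constant of [zdir Z] cancels the denominator in [tau], leaving the factor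
     [eps]. *)
  rewrite tauB mulrA [zconst Z * _]mulrC divfK// -mulrA ler_pM2l// mulrC.
  exact: le_trans mul_ln_le (lerB_dist _ _).
pose T (x : Y) : zsum Y Z := zscale (zdir Z (tau `|x|)) x.
have T_bounds x y :
    (1 - eps) * `|x - y| <= `|T x - T y| <= (1 + eps) * `|x - y|.
  (* The bounds are symmetric in [x] and [y]; the difference of directions must multiply the shorter
     vector. *)
  wlog yx : x y / `|y| <= `|x|.
    move=> wlg; have [/wlg//|/ltW/wlg] := leP `|y| `|x|.
    by rewrite distrC [`|T y - _|]distrC.
  rewrite /T zscale_sub.
  set U := zscale _ (x - y); set V := zscale _ y.
  have U_norm : `|U| = `|x - y| by rewrite norm_zscale norm_zdir mul1r.
  have V_norm : `|V| <= eps * `|x - y| by rewrite norm_zscale rotation_le.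
  have UV1 := ler_normD U V; have UV2 := lerB_normD U V.
  by apply/andP; split; lra.
exists T; split => //; last by move=> x; rewrite norm_zscale norm_zdir mul1r.
have one_sub_eps : 0 < 1 - eps by rewrite subr_gt0.
have lowerT x y : (1 - eps) * `|x - y| <= `|T x - T y|.
  by have /andP[] := T_bounds x y.
have upperT x y : `|T x - T y| <= (1 + eps) * `|x - y|.
  by have /andP[] := T_bounds x y.
have one_add_eps : 0 <= 1 + eps by lra.
split.
- by rewrite ler_pdivlMr// mul1r; lra.
- by rewrite r_gt0.
- split; first exact: bilipschitz_embedding_bounds lowerT upperT.
  exact: distortion_le lowerT upperT.
(* In the inner ball the radius clamps to [r], so the angle is [ln 1 = 0] up to a factor. *)
- move=> y yr; rewrite /T /tau /sg /truncate (max_idPr yr).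
  rewrite (min_idPl (ltW r_lt_rho)) divff ?gt_eqF// ln1 mulr0 zdir0.
  by rewrite /zscale /= scale1r scale0r.
(* In the exterior it clamps to [rho], so [hrrho] gives the angle [pi / 2]. *)
- move=> y yrho; rewrite /T /tau /sg /truncate.
  rewrite (min_idPr _) ?le_max ?yrho// hrrho zdir_pihalf.
  by rewrite /zscale /= scale1r scale0r.
Qed.
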